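(* Let $G$ be a finite group with a unique subgroup $A$ of order $2$. Then $A$ is $\omega$-admissible for every normalized $3$-cocycle $\omega\in Z^3(G,\mathbb{C}^\times)$.
   Context: All groups are finite; $\mathbb{C}^\times$ has trivial action; $g^x=x^{-1}gx$; $\widehat G=\mathrm{Hom}(G,\mathbb{C}^\times)$. A normalized $3$-cocycle is $\omega:G^3\to\mathbb{C}^\times$ with $\omega(y,z,w)\,\omega(x,yz,w)\,\omega(x,y,z)=\omega(xy,z,w)\,\omega(x,y,zw)$ and value $1$ whenever an argument is $1$. Put $$\theta_g(x,y)=\frac{\omega(g,x,y)\,\omega(x,y,g^{xy})}{\omega(x,g^x,y)},\qquad \gamma_g(x,y)=\frac{\omega(x,y,g)\,\omega(g,x^g,y^g)}{\omega(x,g,y^g)}.$$ For a $1$-cochain $f$, $\delta f(x,y)=f(x)f(y)/f(xy)$. If $g\in Z(G)$ then $\theta_g=\gamma_g$ is a $2$-cocycle on $G$; $Z_\omega(G)=\{g\in Z(G):\gamma_g\in B^2(G,\mathbb{C}^\times)\}$, a subgroup of $Z(G)$. $\Gamma_0^\omega(G)$ is the group of central group-like elements of the twisted quantum double $D^\omega(G)$; concretely its elements are the formal sums $u=\sum_{g\in G}\tau(g)\,e_gx$ with $x\in Z_\omega(G)$ and $\tau:G\to\mathbb{C}^\times$ satisfying $\delta\tau=\theta_x$, with product $\bigl(\sum_g\tau(g)e_gx\bigr)\bigl(\sum_g\tau'(g)e_gy\bigr)=\sum_g\theta_g(x,y)\tau(g)\tau'(g)\,e_g\,xy$. There is an exact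 sequence $1\to\widehat G\xrightarrow{\iota}\Gamma_0^\omega(G)\xrightarrow{p}Z_\omega(G)\to1$ with $\iota(\chi)=\sum_g\chi(g)e_g1$ and $p(\sum_g\tau(g)e_gx)=x$. For a subgroup $A\subseteq Z_\omega(G)$, $\Gamma_0^\omega(G,A)=p^{-1}(A)$. A subgroup $A\subseteq Z(G)$ is called $\omega$-admissible if (a) $A\subseteq Z_\omega(G)$, and (b) the exact sequence $1\to\widehat G\to\Gamma_0^\omega(G,A)\to A\to1$ splits. *)

(* Defs.v *)
From mathcomp Require Import all_boot all_order all_algebra all_fingroup.
From mathcomp Require Import all_solvable ring.

Set Implicit Arguments.
Unset Strict Implicit.
Unset Printing Implicit Defensive.

Import GroupScope GRing.Theory.
Local Open Scope ring_scope.

(* The finite group is the whole type [G : finGroupType]; cochains with values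
   in the multiplicative group of the field [F] are [F]-valued functions that
   vanish nowhere. [x ^ y] is the conjugate y^-1 x y. *)

Section Cochains.
Variables (F : fieldType) (G : finGroupType).
Implicit Types (f : G -> F) (c : G -> G -> F) (w : G -> G -> G -> F).
Implicit Types (g x y z t : G).

Definition is_normalized_3cocycle w : Prop :=
  [/\ forall x y z, w x y z != 0,
      forall x y z t,
        w y z t * w x (y * z)%g t * w x y z = w (x * y)%g z t * w x y (z * t)%g
    & forall x y, [/\ w 1%g x y = 1, w x 1%g y = 1 & w x y 1%g = 1]].

Definition delta1 f x y : F := f x * f y / f (x * y)%g.

Definition is_2coboundary c : Prop :=
  exists f, (forall x, f x != 0) /\ (forall x y, c x y = delta1 f x y).

Definition theta w g x y : F :=
  w g x y * w x y (g ^ (x * y))%g / w x (g ^ x)%g y.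

Definition gamma w g x y : F :=
  w x y g * w g (x ^ g)%g (y ^ g)%g / w x g (y ^ g)%g.

Definition Zomega w g : Prop :=
  g \in 'Z([set: G]) /\ is_2coboundary (gamma w g).

End Cochains.

Section Gamma0.
Variables (F : fieldType) (G : finGroupType).
Implicit Types (w : G -> G -> G -> F) (A : {group G}).

(* The pair (tau, x) stands for the formal sum \sum_g tau(g) e_g x. *)
Definition formal_sum : Type := ({ffun G -> F} * G)%type.

Implicit Types (u v : formal_sum).

Definition fs_mul w u v : formal_sum :=
  ([ffun g => theta w g u.2 v.2 * u.1 g * v.1 g], (u.2 * v.2)%g).

Definition Gamma0 w u : Prop :=
  [/\ Zomega w u.2, forall g, u.1 g != 0
    & forall g h, delta1 u.1 g h = theta w u.2 g h].

Definition Gamma0_iota (chi : {ffun G -> F}) : formal_sum := (chi, 1%g).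

Definition Gamma0_p u : G := u.2.

Definition Gamma0_over w A u : Prop := Gamma0 w u /\ Gamma0_p u \in A.

(* A splitting of 1 -> Hom(G, F^x) -> Gamma0_over w A -> A -> 1 is a
   homomorphic section of [Gamma0_p] defined on A. *)
Definition Gamma0_splits w A : Prop :=
  exists s : G -> formal_sum,
    [/\ {in A, forall a, Gamma0_over w A (s a)},
        {in A, forall a, Gamma0_p (s a) = a}
      & {in A &, {morph s : a b / (a * b)%g >-> fs_mul w a b}}].

Definition is_admissible w A : Prop :=
  [/\ A \subset 'Z([set: G]), {in A, forall a, Zomega w a}
    & Gamma0_splits w A].

End Gamma0.

(* Exactness of 1 -> Hom(G, F^x) -> Gamma0 w -> Zomega w -> 1 in the middle
   and on the right. *)
Lemma Gamma0_ker (F : fieldType) (G : finGroupType) (w : G -> G -> G -> F)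
    (wZ : is_normalized_3cocycle w) (u : formal_sum F G) :
  (Gamma0 w u /\ Gamma0_p u = 1%g) <->
  exists2 chi : {ffun G -> F},
    (forall g, chi g != 0) /\ {morph chi : g h / (g * h)%g >-> g * h}
    & u = Gamma0_iota chi.
Proof.
have [w0 dw w1] := wZ.
have t1 g h : theta w 1%g g h = 1.
  rewrite /theta !conj1g; have [-> _ _] := w1 g h; have [_ -> ->] := w1 g h.
  by rewrite mulr1 divr1.
split=> [[]|[chi [chi0 chiM] ->]].
  case: u => tau x [/= _ tau0 dtau] x1; rewrite /Gamma0_p /= in x1.
  exists tau; last by rewrite /Gamma0_iota x1.
  split=> // g h; move: (dtau g h); rewrite x1 t1 /delta1.
  by move/(canRL (mulfVK (tau0 _))); rewrite mul1r.
split=> //; split=> //=; last first.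
  by move=> g h; rewrite t1 /delta1 chiM divff // mulf_neq0.
split; first exact: group1.
exists (fun=> 1); split=> [x|x y]; first exact: oner_neq0.
rewrite /delta1 /gamma !conjg1; have [-> _ _] := w1 x y; have [_ -> ->] := w1 x y.
by rewrite !mulr1.
Qed.

Lemma Gamma0_p_onto (F : fieldType) (G : finGroupType)
    (w : G -> G -> G -> F) (x : G) :
  Zomega w x <-> exists2 u, Gamma0 w u & Gamma0_p u = x.
Proof.
split=> [zx|[u [zu _ _] <-] //]; have [xZ [f [f0 df]]] := zx.
have /centerP [_ cx] := xZ.
have cx' z : (x * z)%g = (z * x)%g by apply: cx; rewrite inE.
have jx z : (z ^ x)%g = z by rewrite conjgE -cx' mulKg.
have xj z : (x ^ z)%g = x by rewrite conjgE cx' mulKg.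
exists (finfun f, x) => //; split=> //= [g|g h]; first by rewrite ffunE.
rewrite /delta1 !ffunE -[LHS]df /gamma /theta !jx !xj.
by rewrite (mulrC (w g h x)).
Qed.

(* Compatibility of theta with the product of central elements; it makes
   [Gamma0] closed under [fs_mul]. *)
Lemma theta_mul (F : fieldType) (G : finGroupType) (w : G -> G -> G -> F)
    (wZ : is_normalized_3cocycle w) (x y g h : G) :
  x \in 'Z([set: G]) -> y \in 'Z([set: G]) ->
  theta w (x * y)%g g h = theta w x g h * theta w y g h *
    (theta w g x y * theta w h x y / theta w (g * h)%g x y).
Proof.
have [w0 dw w1] := wZ.
move=> /centerP [_ cx] /centerP [_ cy].
have cx' z : (x * z)%g = (z * x)%g by apply: cx; rewrite inE.
have cy' z : (y * z)%g = (z * y)%g by apply: cy; rewrite inE.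
have jx z : (z ^ x)%g = z by rewrite conjgE -cx' mulKg.
have jy z : (z ^ y)%g = z by rewrite conjgE -cy' mulKg.
have xj z : (x ^ z)%g = x by rewrite conjgE cx' mulKg.
have yj z : (y ^ z)%g = y by rewrite conjgE cy' mulKg.
rewrite /theta !conjMg !conjgM !jx !jy !xj !yj.
pose d a b c e := w b c e * w a (b * c)%g e * w a b c /
  (w (a * b)%g c e * w a b (c * e)%g).
have dE a b c e : d a b c e = 1 by rewrite /d dw divff // mulf_neq0.
have: d x y g h * d x g h y * d g h x y * d g x y h / d x g y h / d g x h y = 1.
  by rewrite !dE !mulr1 !invr1 !mulr1.
rewrite /d (cx' g) (cx' h) (cy' g) (cy' h) (cx' y).
rewrite -?mulgA => E.
rewrite -[LHS]mulr1 -[in LHS]E.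
field.
by rewrite !w0.
Qed.

Lemma Gamma0_mul (F : fieldType) (G : finGroupType) (w : G -> G -> G -> F)
    (wZ : is_normalized_3cocycle w) (u v : formal_sum F G) :
  Gamma0 w u -> Gamma0 w v -> Gamma0 w (fs_mul w u v).
Proof.
case: u v => [s x] [t y] [/= zx s0 ds] [/= zy t0 dt].
have [w0 _ _] := wZ; have [xZ _] := zx; have [yZ _] := zy.
have th0 a b c : theta w a b c != 0.
  by rewrite /theta mulf_neq0 ?invr_eq0 ?mulf_neq0.
have st0 g : (fs_mul w (s, x) (t, y)).1 g != 0.
  by rewrite ffunE /= (mulf_neq0 (mulf_neq0 _ _)).
have dst g h : delta1 (fs_mul w (s, x) (t, y)).1 g h = theta w (x * y)%g g h.
  rewrite (theta_mul wZ) // -ds -dt /delta1 !ffunE /=.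
  by field; rewrite !th0 !s0 !t0.
split=> //; split; first exact: groupM.
exists (fs_mul w (s, x) (t, y)).1; split=> // g h; rewrite dst.
have /centerP [_ cz] : (x * y)%g \in 'Z([set: G]) by exact: groupM.
have cz' z : (x * y * z)%g = (z * (x * y))%g by apply: cz; rewrite inE.
have jz z : (z ^ (x * y))%g = z by rewrite conjgE -cz' mulKg.
have zj z : ((x * y) ^ z)%g = (x * y)%g by rewrite conjgE cz' mulKg.
by rewrite /gamma /theta !jz !zj (mulrC (w g h _)).
Qed.

(* Main.v *)
Require Import Defs.
From HB Require Import structures.
From mathcomp Require Import all_boot all_order all_algebra all_fingroup.
From mathcomp Require Import all_solvable ring.
From mathcomp Require Import reals complex.

(** Let [A = {1, z}]; uniqueness makes [z] central.  A splitting over [A] is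
    the same thing as a cochain [tau] with [delta tau = theta_z] and
    [theta_g(z,z) tau(g)^2 = 1] for all [g]
    ([admissible_of_trivialization]).  The second condition determines
    [tau(g)] up to sign: let [k(g)] be a square root of [1 / theta_g(z,z)].
    The compatibility of [theta] with products of central elements, at
    [z z = 1], says that [theta_z^2] is the coboundary of
    [g |-> 1 / theta_g(z,z)]; hence [theta_z / delta k] takes its values in
    [{1, -1}], and what has to be shown is that this sign cocycle [b] is the
    coboundary of a sign cochain, that is, that the central extension [E] of
    [G] by a group of order 2 defined by [b] splits.

    By Gaschutz's theorem it is enough to split [E] over a Sylow 2-subgroup.
    A Sylow 2-subgroup of [G] has a single involution, so it is cyclic or
    generalized quaternion, and two facts about squares in [E] suffice.

    - Lifts of [z] square to 1, because [b(z,z) = w(z,z,z)^2 = 1].  If the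
      Sylow subgroup is cyclic, a lift [s] of a generator then has the order
      of its image, and [<[s]>] is a complement.
    - If [x^2 = y^2 = z] and [x^y = x^-1], then lifts of [x] and [y] have the
      same square ([quaternion_holonomy]).  In the generalized quaternion case
      all lifts of elements of order 4 then have the same square, which forces
      lifts of the standard generators to satisfy the quaternion relations, so
      that they generate a complement.

    The second fact is the deeper one: it fails for some sign cocycles [b] on
    the quaternion group of order 8 with [b(z,z) = 1], so it has to come from
    [w].  The number [theta_x(z,z) theta_z(x,x)] is the value of [w] on a
    3-cycle supported on [<[x]>], and this cycle is homologous to its analogue
    for [y] in the quaternion group generated by [x] and [y].  The reason is
    that the third homology of this group is cyclic of order 8, so that an
    automorphism of order 3 permuting the subgroups of order 4 acts trivially
    on it.  The proof exhibits a bounding 4-chain. *)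

Set Implicit Arguments.
Unset Strict Implicit.
Unset Printing Implicit Defensive.

Import GroupScope Order.TTheory GRing.Theory Num.Theory.

(** * Splitting a 2-group extension by lifting generators *)

Section GroupTheory.
Local Open Scope group_scope.
Section SplitByLift.
Variables (gT rT : finGroupType) (D P : {group gT}).
Variable f : {morphism D >-> rT}.
Hypotheses (sPD : P \subset D) (sKP : 'ker f \subset P).

(** A subgroup that still covers the quotient is a complement of the kernel as
    soon as it is not larger than the quotient. *)
Lemma splits_of_small_lift (K : {group gT}) :
    K \subset P -> f @* P \subset f @* K -> #|K| <= #|f @* P| ->
  [splits P, over 'ker f].
Proof.
move=> sKP' sfP leK.
have fK : f @* K = f @* P by apply/eqP; rewrite eqEsubset sfP morphimS.
have sKD := subset_trans sKP' sPD.
have defP : 'ker f * K = P by rewrite -morphimK // fK morphimGK.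
apply/splitsP; exists K; apply/complP; split=> //.
apply: cardMg_TI; rewrite defP.
rewrite -(Lagrange sKP) leq_mul2l (leq_trans leK) ?orbT //.
by rewrite card_morphim (setIidPr sPD).
Qed.

(* By taking powers, the order of every nontrivial 2-element is then unchanged
   by lifting. *)
Hypothesis lift2 : {in P, forall s, #[f s] = 2 -> s ^+ 2 = 1}.

Lemma expg_lift s k :
  s \in P -> (k > 0)%N -> #[f s] = (2 ^ k)%N -> s ^+ (2 ^ k) = 1.
Proof.
move=> Ps k_gt0 ofs; rewrite -(prednK k_gt0) expnSr expgM lift2 ?groupX //.
rewrite morphX ?(subsetP sPD) // orderXdiv ofs ?dvdn_exp2l ?leq_pred //.
by rewrite -{1}(prednK k_gt0) expnSr mulKn ?expn_gt0.
Qed.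

Lemma splits_cyclic_2group : 2.-group (f @* P) -> cyclic (f @* P) ->
  [splits P, over 'ker f].
Proof.
move=> p2 /cyclicP[g defg].
have : g \in f @* P by rewrite defg cycle_id.
case/morphimP=> s Ds Ps defs.
have [g1|ntg] := eqVneq g 1.
  apply: (@splits_of_small_lift 1%G); rewrite ?sub1G // ?cards1 ?cardG_gt0 //.
  by rewrite defg g1 cycle1 sub1G.
have /p_natP[k og] : 2.-nat #[g] by move: p2; rewrite defg.
apply: (@splits_of_small_lift <[s]>%G); rewrite ?cycle_subG //.
  by rewrite morphim_cycle // -defs defg.
rewrite defg -!orderE og dvdn_leq ?expn_gt0 // order_dvdn expg_lift -?defs //.
by case: k og ntg => // /eqP; rewrite order_eq1 => /eqP->; rewrite eqxx.
Qed.

(* When [f @* P] has a single involution, [f s] and [f t] generate a quaternion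
   group of order 8. *)
Hypothesis lift4 : {in P &, forall s t, #[f s] = 4 -> #[f t] = 4 ->
  f s ^ f t = (f s)^-1 -> s ^+ 2 = t ^+ 2}.

(** Let [s], [t] lift the standard generators [x], [y], and let [u] be the power
    of [s] lifting the element of order 4 of [<[x]>].  Both [y] and [x * y]
    invert this element, so [lift4] gives [t^2 = (s * t)^2 = u^2].  The first
    equality means [s ^ t = s^-1], and with [u^2 = t^2] these are the defining
    relations of the quaternion group. *)
Lemma splits_quaternion n : (n > 2)%N -> f @* P \isog 'Q_(2 ^ n) ->
  [splits P, over 'ker f].
Proof.
case: n => [|[|[|n]]] // _; set m := n.+3 => isoQ; have m_gt2 : (m > 2)%N by [].
have [[x y] genQ [oy y2 xy]] := generators_quaternion m_gt2 isoQ.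
have [Q1 _ _ _ _] := quaternion_structure m_gt2 genQ isoQ.
have [_ o4 inv4] := Q1.
have [oQ Qx ox /setDP[Qy X'y]] := genQ.
rewrite /m /= in y2 ox oQ.
have /morphimP[s Ds Ps defx] := Qx; have /morphimP[t Dt Pt defy] := Qy.
pose u := s ^+ (2 ^ n).
have Pu : u \in P by rewrite groupX.
have fu : f u = x ^+ (2 ^ n) by rewrite morphX // -defx.
have ou : #[f u] = 4.
  rewrite fu orderXdiv ox ?dvdn_exp2l // 2?expnS ?mulnA ?mulnK ?expn_gt0 //.
  by rewrite !leqW.
have uy : f u ^ f t = (f u)^-1 by rewrite fu -defy conjXg xy expgVn.
have t2 : s ^+ (2 ^ n.+1) = t ^+ 2.
  by rewrite expnSr expgM (lift4 Pu Pt) // -defy.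
have X'xy : x * y \in f @* P :\: <[x]>.
  by rewrite inE groupMl ?cycle_id // X'y groupM.
have st2 : s ^+ (2 ^ n.+1) = (s * t) ^+ 2.
  rewrite expnSr expgM (lift4 Pu (groupM Ps Pt)) //.
    by rewrite morphM // -defx -defy o4.
  by rewrite morphM // -defx -defy inv4 // fu mem_cycle.
have sts : s ^ t = s^-1.
  apply: (mulgI t); rewrite -conjgC; apply: (mulIg s); rewrite mulgKV.
  by apply: (mulIg t); rewrite -mulgA; move: st2; rewrite t2 => /esym.
have s1 : s ^+ (2 ^ n.+2) = 1 by apply: expg_lift; rewrite -?defx.
have os : #[s] = (2 ^ n.+2)%N.
  by apply/eqP; rewrite eqn_dvd order_dvdn s1 eqxx -ox defx morph_order.
have t4 : t ^+ 4 = 1 by rewrite (expgM t 2 2) -t2 -expgM -expnSr.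
apply: (@splits_of_small_lift (<[s]> <*> <[t]>)%G) => /=.
- by rewrite join_subG !cycle_subG Ps.
- rewrite morphimY ?cycle_subG // !morphim_cycle // -defx -defy.
  by have [/pprodP[_ defQ nXY] _ _] := Q1; rewrite norm_joinEr ?defQ.
have nst : <[t]> \subset 'N(<[s]>) by rewrite norms_cycle sts groupV cycle_id.
(* The two cyclic groups share [t^2], so their product is as small as the
   quaternion group itself. *)
have o_st : 2 <= #|<[s]> :&: <[t]>|.
  have <- : #[t ^+ 2] = 2.
    apply/eqP; rewrite (eqn_dvd _ 2) order_dvdn -expgM t4 eqxx /=.
    have := morph_order f (groupX 2 Dt).
    by rewrite morphX // orderXdiv -defy oy.
  by rewrite subset_leq_card // subsetI !cycle_subG -{1}t2 !mem_cycle.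
rewrite norm_joinEr // oQ -(@leq_pmul2r 2) //.
apply: leq_trans (leq_mul (leqnn _) o_st) _.
rewrite -mul_cardG -!orderE os (expnSr 2 n.+2) -mulnA.
rewrite leq_mul2l dvdn_leq ?orbT //.
by rewrite order_dvdn t4.
Qed.
End SplitByLift.

(** * The central extension defined by a sign cocycle *)

Section SignExtension.
Variables (G : finGroupType) (b : G -> G -> bool).

Record sign_cocycle : Prop := SignCocycle {
  sign_cocycleA : forall x y t,
    b y t (+) b x (y * t) = b (x * y) t (+) b x y;
  sign_cocycle1 : forall x, b 1 x = false }.

(** Signs are booleans, multiplied by [addb].  The cocycle proof is a parameter
    of the carrier so that the group structure can be found from the type. *)
Definition sign_ext of sign_cocycle : Type := (bool * G)%type.

Variable bP : sign_cocycle.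
Notation E := (sign_ext bP).
HB.instance Definition _ := Finite.on E.

Definition sign_ext_mul (u v : E) : E := (u.1 (+) v.1 (+) b u.2 v.2, u.2 * v.2).
Definition sign_ext_one : E := (false, 1).
Definition sign_ext_inv (u : E) : E := (u.1 (+) b u.2^-1 u.2, u.2^-1).

Fact sign_ext_mulA : associative sign_ext_mul.
Proof.
case=> r x [s y] [t g]; congr (_, _); last exact: mulgA.
rewrite /=; have := sign_cocycleA bP x y g.
by case: r; case: s; case: t; do 4!case: (b _ _).
Qed.

Fact sign_ext_mul1 : left_id sign_ext_one sign_ext_mul.
Proof.
by case=> r x; rewrite /sign_ext_mul /= (sign_cocycle1 bP) addbF mul1g.
Qed.

Fact sign_ext_mulV : left_inverse sign_ext_one sign_ext_inv sign_ext_mul.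
Proof.
by case=> r x; rewrite /sign_ext_mul /= addbAC addbK addbb mulVg.
Qed.

HB.instance Definition _ :=
  Finite_isGroup.Build E sign_ext_mulA sign_ext_mul1 sign_ext_mulV.

Definition sign_ext_proj (u : E) : G := u.2.
Lemma sign_ext_projM : {in [set: E] &, {morph sign_ext_proj : u v / u * v}}.
Proof. by []. Qed.
Canonical sign_ext_proj_morphism := Morphism sign_ext_projM.

Lemma sign_ext_sqr (u : E) : u ^+ 2 = (b u.2 u.2, u.2 ^+ 2) :> E.
Proof. by rewrite [LHS]/(sign_ext_mul u u) /sign_ext_mul addbb. Qed.

Lemma card_ker_sign_ext_proj : #|'ker sign_ext_proj| = 2.
Proof.
have -> : 'ker sign_ext_proj = [set ((false, 1) : E); ((true, 1) : E)].
  apply/setP=> -[[] x]; rewrite !inE ![_ == _ :> sign_ext _]xpair_eqE /=;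
    by rewrite ?orbF.
by rewrite cards2.
Qed.

(** For each [x] a complement contains exactly one of its two lifts; the sign of
    this lift is the cochain that trivializes [b]. *)
Lemma sign_ext_split : [splits [set: E], over 'ker sign_ext_proj] ->
  exists e : G -> bool, forall x y, b x y = e x (+) e y (+) e (x * y).
Proof.
case/splitsP=> K /complP[tiK defE].
have uniqK r s x : ((r, x) : E) \in K -> ((s, x) : E) \in K -> r = s.
  move=> Kr Ks.
  have : ((r, x) : E) * ((s, x) : E)^-1 \in 'ker sign_ext_proj :&: K.
    rewrite in_setI (groupM Kr (groupVr Ks)) andbT !inE /=.
    by rewrite /sign_ext_proj /= mulgV.
  by rewrite tiK => /set1P/eqP; rewrite -eq_mulgV1 => /eqP[].
have K_e x : (((((true, x) : E) \in K), x) : E) \in K.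
  have : ((false, x) : E) \in 'ker sign_ext_proj * K by rewrite defE inE.
  case/imset2P=> -[r c] [s y]; rewrite !inE => /eqP.
  rewrite /sign_ext_proj /= => -> Ks [_ ->].
  rewrite mul1g; case: s Ks => [Kt|Kf]; first by rewrite Kt.
  by case Kt: (((true, _) : E) \in K) => //; have := uniqK _ _ _ Kf Kt.
exists (fun x => ((true, x) : E) \in K) => x y.
have Kxy := groupM (K_e x) (K_e y).
by have := uniqK _ _ _ Kxy (K_e (x * y)); move=> <-; rewrite addKb.
Qed.

End SignExtension.

(** Gaschutz's theorem reduces the splitting to a Sylow 2-subgroup of the
    extension.  Its image is a Sylow 2-subgroup of [G], whose only involution is
    [z], hence is cyclic or generalized quaternion. *)
Lemma sign_cocycle_split (G : finGroupType) (b : G -> G -> bool) (z : G)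
    (oz : #[z] = 2) (uniq_z : forall g, #[g] = 2 -> g = z) :
    sign_cocycle b -> b z z = false ->
    (forall x y, #[x] = 4 -> #[y] = 4 -> x ^ y = x^-1 -> b x x = b y y) ->
  exists e : G -> bool, forall x y, b x y = e x (+) e y (+) e (x * y).
Proof.
move=> bP bz b4; apply: (@sign_ext_split G b bP).
set E := [set: sign_ext bP]; set f := @sign_ext_proj G b bP.
have [P sylP] := Sylow_exists 2 E.
have [sPE pP _] := and3P sylP.
have pK : 2.-group ('ker f) by rewrite /pgroup card_ker_sign_ext_proj.
have nsKE : 'ker f <| E by apply: ker_normal.
have sKP : 'ker f \subset P := normal_sub_max_pgroup (Hall_max sylP) pK nsKE.
rewrite (Gaschutz_split nsKE sKP sPE); last 2 first.
- by apply/cyclic_abelian/prime_cyclic; rewrite card_ker_sign_ext_proj.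
- by rewrite (pnat_coprime pK) //; case/and3P: sylP.
have lift2 : {in P, forall s, #[f s] = 2 -> s ^+ 2 = 1}.
  move=> s _ /uniq_z fs; have {}fs : s.2 = z := fs; rewrite sign_ext_sqr fs bz.
  by rewrite -oz expg_order.
have lift4 : {in P &, forall s t, #[f s] = 4 -> #[f t] = 4 ->
    f s ^ f t = (f s)^-1 -> s ^+ 2 = t ^+ 2}.
  move=> s t _ _ os ot st; rewrite !sign_ext_sqr (b4 _ _ os ot st).
  have sqz (g : G) : #[g] = 4 -> g ^+ 2 = z.
    by move=> og; apply: uniq_z; rewrite orderXdiv og.
  by rewrite (sqz t.2 ot) (sqz s.2 os).
have pfP : 2.-group (f @* P) by rewrite morphim_pgroup.
have [fP1|ntfP] := eqVneq (f @* P) 1%g.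
  by apply: splits_cyclic_2group => //; rewrite fP1 cyclic1.
have oOhm : #|'Ohm_1(f @* P)| = 2.
  have [_ dvd2 _] := pgroup_pdiv pfP ntfP.
  have [g Pg og] := Cauchy (isT : prime 2) dvd2.
  rewrite -oz orderE; congr #|pred_of_set _|.
  apply/eqP; rewrite eqEsubset (OhmE _ pfP) gen_subG; apply/andP; split.
    apply/subsetP=> h; rewrite !inE => /andP[_ /eqP h2].
    have [->|nth] := eqVneq h 1%g; first exact: group1.
    by rewrite (uniq_z h) ?cycle_id //; apply: nt_prime_order.
  rewrite cycle_subG -(uniq_z g og) mem_gen // !inE Pg /= -og expg_order //.
have := oOhm; move/(prime_Ohm1P pfP ntfP); case/orP => [cyc|/andP[_ /eqP]].
  exact: splits_cyclic_2group.
case/quaternion_classP=> n n_gt2 isoQ.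
exact: (splits_quaternion sPE sKP lift2 lift4 n_gt2 isoQ).
Qed.
End GroupTheory.

Local Open Scope ring_scope.

(** * Slant products with a central involution *)

Section CentralInvolution.
Variables (F : fieldType) (G : finGroupType) (w : G -> G -> G -> F).
Hypothesis wZ : is_normalized_3cocycle w.
Variable z : G.
Hypothesis zZ : z \in 'Z([set: G]).

Lemma conj_central x : (z ^ x = z)%g.
Proof.
by case/centerP: zZ => _ cz; rewrite conjgE cz ?inE // mulKg.
Qed.

Lemma conjg_central x : (x ^ z = x)%g.
Proof.
by case/centerP: zZ => _ cz; rewrite conjgE -cz ?inE // mulKg.
Qed.

Lemma theta_central x y : theta w z x y = w z x y * w x y z / w x z y.
Proof. by rewrite /theta !conj_central. Qed.

Lemma theta_neq0 g x y : theta w g x y != 0.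
Proof.
by case: wZ => w0 _ _; rewrite /theta mulf_neq0 ?invr_eq0 ?mulf_neq0.
Qed.

Lemma theta1gx x y : theta w 1%g x y = 1.
Proof.
case: wZ => _ _ w1; rewrite /theta !conj1g.
by have [-> _ _] := w1 x y; have [_ -> ->] := w1 x y; rewrite mulr1 divr1.
Qed.

Lemma thetag1x g y : theta w g 1%g y = 1.
Proof.
case: wZ => _ _ w1; rewrite /theta mul1g conjg1.
have [_ -> _] := w1 g y; have [-> _ _] := w1 y (g ^ y)%g.
by have [-> _ _] := w1 g y; rewrite mulr1 divr1.
Qed.

Lemma thetagx1 g x : theta w g x 1%g = 1.
Proof.
case: wZ => _ _ w1; rewrite /theta mulg1.
have [_ _ ->] := w1 g x.
by have [_ -> ->] := w1 x (g ^ x)%g; rewrite mulr1 divr1.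
Qed.

(** The shuffles of [z] into [(x, y, t)] give four cocycle conditions, whose
    alternating product is the 2-cocycle condition for [theta_z]. *)
Lemma theta_cocycle x y t :
  theta w z y t * theta w z x (y * t)%g = theta w z (x * y)%g t * theta w z x y.
Proof.
rewrite !theta_central; case: wZ => w0 dw _.
pose d a b c e := w b c e * w a (b * c)%g e * w a b c /
  (w (a * b)%g c e * w a b (c * e)%g).
have dE a b c e : d a b c e = 1 by rewrite /d dw divff // mulf_neq0.
have: d x z y t * d x y t z / (d z x y t * d x y z t) = 1.
  by rewrite !dE !mulr1 divr1.
case/centerP: zZ => _ cz.
rewrite /d -!(cz _ (in_setT _)) => E.
rewrite -[RHS]mulr1 -E; field.
by rewrite !w0.
Qed.

Hypothesis zz : (z * z = 1)%g.

(** [theta_z^2] is the coboundary of [g |-> 1 / theta_g(z,z)], because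
    [theta_(z z)] is trivial. *)
Lemma theta_sqr g h :
  theta w z g h ^+ 2 *
    (theta w g z z * theta w h z z / theta w (g * h)%g z z) = 1.
Proof. by rewrite expr2 -(theta_mul wZ) // zz theta1gx. Qed.

Lemma w_involution_sqr : w z z z ^+ 2 = 1.
Proof.
case: wZ => _ dw w1; have := dw z z z z; rewrite !zz.
have [_ -> _] := w1 z z; have [-> _ _] := w1 z z; have [_ _ ->] := w1 z z.
by rewrite !mulr1.
Qed.

Lemma theta_zzz : theta w z z z = w z z z.
Proof. by case: wZ => w0 _ _; rewrite theta_central mulfK. Qed.

(** Each side is the value of [w] on a 3-cycle supported on a cyclic group of
    order 4, [<[x]>] or [<[y]>].  The two cycles are homologous over the
    integers in the quaternion group generated by [x] and [y], and their
    difference is the boundary of a chain of fourteen tetrahedra, one for each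
    cocycle condition used below.  Besides [x], [y], [z] and inverses, these
    involve the third generator [h = x^-1 y]. *)
Lemma quaternion_holonomy x y :
    (x * x = z)%g -> (y * y = z)%g -> (x ^ y = x^-1)%g ->
  theta w z x x * theta w x z z = theta w z y y * theta w y z z.
Proof.
move=> xx yy xy; case: wZ => w0 dw w1.
have w1l a b : w 1%g a b = 1 by have [] := w1 a b.
have w1r a b : w a b 1%g = 1 by have [] := w1 a b.
pose d a b c e := w b c e * w a (b * c)%g e * w a b c /
  (w (a * b)%g c e * w a b (c * e)%g).
have dE a b c e : d a b c e = 1 by rewrite /d dw divff // mulf_neq0.
pose u := (x^-1)%g; pose l := (y^-1)%g; pose h := (u * y)%g.
have zx : (z * x = u)%g by apply: (mulIg x); rewrite -mulgA xx zz mulVg.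
have zy : (z * y = l)%g by apply: (mulIg y); rewrite -mulgA yy zz mulVg.
have xz : (x * z = u)%g by apply: (mulgI x); rewrite mulgA xx zz mulgV.
have yz : (y * z = l)%g by apply: (mulgI y); rewrite mulgA yy zz mulgV.
have yx : (x * y = y * u)%g by rewrite conjgC xy.
have zu : (z * u = x)%g by rewrite -xx mulgK.
have uu : (u * u = z)%g by rewrite -{1}xz -mulgA zu xx.
have uy : (u * y = y * x)%g.
  by apply: (mulgI x); rewrite mulKVg mulgA yx mulgKV.
have hx : (h * x = l)%g by rewrite /h -mulgA -uy mulgA uu.
have yh : (y * h = u)%g by rewrite /h uy mulgA yy.
have hu : (h * u = y)%g by rewrite /h -mulgA -yx mulKg.
have uh : (u * h = l)%g by rewrite /h mulgA uu.
have hl : (h * l = u)%g by rewrite mulgK.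
have lh : (l * h = x)%g by rewrite /h uy mulKg.
(* The bounding chain: tetrahedra in the denominator have coefficient -1. *)
have: d z z x x * d x x z z * d z y z y * d y h x z * d x z y h * d u h u h *
   d l h l h / (d z z y y * d y y z z * d x z x z * d z y h x * d h x z y *
   d h u h u * d h l h l) = 1.
  by rewrite !dE !mulr1 divr1.
rewrite /theta !conj_central !conjg_central zz !conjg1 /d.
rewrite !zz !xx !yy !zx !zy !xz !yz !hx !yh !hu !uh !hl !lh.
rewrite !w1l !w1r => E.
rewrite -[RHS]mulr1 -E; field.
by rewrite !w0.
Qed.

(** The section sending 1 to the unit and [z] to [(tau, z)] is multiplicative
    exactly when the square of [(tau, z)] is the unit, that is, when
    [theta_g(z,z) tau(g)^2 = 1] for all [g]. *)
Lemma admissible_of_trivialization (A : {group G}) (tau : G -> F) :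
    z != 1%g -> A :=: [set 1%g; z] ->
    (forall g, tau g != 0) ->
    (forall g h, delta1 tau g h = theta w z g h) ->
    (forall g, theta w g z z * tau g ^+ 2 = 1) ->
  is_admissible w A.
Proof.
move=> ntz defA tau0 dtau tau2.
have ztau : Zomega w z.
  split=> //; exists tau; split=> // x y.
  by rewrite dtau theta_central /gamma !conjg_central (mulrC (w x y z)).
have z1 : Zomega w (1%g : G).
  split; first exact: group1.
  exists (fun=> 1); split=> [x|x y]; first exact: oner_neq0.
  case: wZ => _ _ w1; rewrite /delta1 /gamma !conjg1.
  by have [-> _ _] := w1 x y; have [_ -> ->] := w1 x y; rewrite !mulr1.
split.
- by rewrite defA; apply/subsetP=> x /set2P[] -> //; apply: group1.
- by move=> a; rewrite defA => /set2P[] ->.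
exists (fun a => if a == 1%g then ([ffun=> 1], 1%g) else (finfun tau, z)).
split=> [a|a|a c]; rewrite ?defA.
- rewrite /Gamma0_over /Gamma0_p defA; case: ifP => _ _.
    split; last exact: set21.
    split=> //= [g|g h]; first by rewrite ffunE oner_neq0.
    by rewrite theta1gx // /delta1 !ffunE !mulr1 divr1.
  split; last exact: set22.
  split=> //= [g|g h]; first by rewrite ffunE.
  by rewrite -dtau /delta1 !ffunE.
- by case/set2P=> ->; rewrite ?eqxx ?(negPf ntz).
have sgl v : fs_mul w ([ffun=> 1], 1%g) v = v.
  case: v => t x; congr (_, _); last by rewrite mul1g.
  by apply/ffunP=> g; rewrite !ffunE thetag1x !mul1r.
have sgr v : fs_mul w v ([ffun=> 1], 1%g) = v.
  case: v => t x; congr (_, _); last by rewrite mulg1.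
  by apply/ffunP=> g; rewrite !ffunE thetagx1 mul1r mulr1.
case/set2P=> -> /set2P[] ->;
  rewrite ?mulg1 ?mul1g ?eqxx ?(negPf ntz) ?sgl ?sgr //.
rewrite zz eqxx /fs_mul /= zz; congr (_, _).
by apply/ffunP=> g; rewrite !ffunE -mulrA -expr2 tau2.
Qed.
End CentralInvolution.

(** * The sign obstruction of a unique involution *)

Section UniqueInvolution.
Variables (C : numClosedFieldType) (G : finGroupType) (w : G -> G -> G -> C).
Hypothesis wZ : is_normalized_3cocycle w.
Variable z : G.
Hypotheses (zZ : z \in 'Z([set: G])) (oz : #[z]%g = 2%N).
Hypothesis uniq_z : forall g : G, #[g]%g = 2%N -> g = z.

Let zz : (z * z = 1)%g.
Proof. by rewrite -(expg_order z) oz. Qed.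

Definition inv_sqrt_theta g : C := sqrtC (theta w g z z)^-1.

Lemma inv_sqrt_theta_neq0 g : inv_sqrt_theta g != 0.
Proof. by rewrite sqrtC_eq0 invr_eq0 theta_neq0. Qed.

Lemma inv_sqrt_theta_sqr g : theta w g z z * inv_sqrt_theta g ^+ 2 = 1.
Proof. by rewrite sqrtCK divff ?theta_neq0. Qed.

Lemma inv_sqrt_theta1 : inv_sqrt_theta 1%g = 1.
Proof. by rewrite /inv_sqrt_theta theta1gx // invr1 sqrtC1. Qed.

Definition theta_defect x y : C := theta w z x y / delta1 inv_sqrt_theta x y.

(** The square is [theta_z^2] divided by the coboundary of
    [g |-> 1 / theta_g(z,z)]. *)
Lemma theta_defect_sqr x y : theta_defect x y ^+ 2 = 1.
Proof.
rewrite -(theta_sqr wZ zZ zz x y) /theta_defect /delta1.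
have t2 g : theta w g z z = (inv_sqrt_theta g ^+ 2)^-1.
  by rewrite sqrtCK invrK.
by rewrite !t2; field; rewrite !inv_sqrt_theta_neq0.
Qed.

Lemma theta_defect_cocycle x y t :
  theta_defect y t * theta_defect x (y * t)%g =
    theta_defect (x * y)%g t * theta_defect x y.
Proof.
have := theta_cocycle wZ zZ x y t; rewrite /theta_defect /delta1 mulgA => E.
transitivity (theta w z y t * theta w z x (y * t)%g *
    inv_sqrt_theta (x * y * t)%g /
      (inv_sqrt_theta x * inv_sqrt_theta y * inv_sqrt_theta t)).
  by field; rewrite !inv_sqrt_theta_neq0.
by rewrite E; field; rewrite !inv_sqrt_theta_neq0.
Qed.

Definition defect_sign x y : bool := theta_defect x y == -1.

Lemma theta_defectE x y : theta_defect x y = (-1) ^+ defect_sign x y.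
Proof.
rewrite /defect_sign; have /eqP := theta_defect_sqr x y.
by rewrite sqrf_eq1 => /orP[] /eqP ->; rewrite ?eqxx // eq_sym eqNr oner_eq0.
Qed.

Lemma defect_sign_cocycle : sign_cocycle defect_sign.
Proof.
split=> [x y t|x].
- apply: (@signr_inj C).
  by rewrite !signr_addb -!theta_defectE theta_defect_cocycle.
- apply: (@signr_inj C); rewrite -theta_defectE /theta_defect /delta1.
  rewrite thetag1x // inv_sqrt_theta1 mul1g !mul1r.
  by rewrite divff ?inv_sqrt_theta_neq0 // invr1.
Qed.

(** The defect at [(z, z)] is [w(z,z,z)^2], and the cocycle condition at
    [(z, z, z, z)] makes it 1. *)
Lemma defect_sign_zz : defect_sign z z = false.
Proof.
apply: (@signr_inj C); rewrite -theta_defectE /theta_defect /delta1 zz.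
rewrite inv_sqrt_theta1 divr1.
by rewrite -expr2 sqrtCK invrK theta_zzz // -expr2 w_involution_sqr.
Qed.

(** The defect at [(x, x)] is [theta_z(x,x) theta_x(z,z)] times a factor that
    depends on [z] only. *)
Lemma defect_sign_order4 x y :
    #[x]%g = 4%N -> #[y]%g = 4%N -> (x ^ y = x^-1)%g ->
  defect_sign x x = defect_sign y y.
Proof.
move=> ox oy xy.
have sq g : #[g]%g = 4%N -> (g * g = z)%g.
  by move=> og; apply: (uniq_z (g := (g ^+ 2)%g)); rewrite orderXdiv og.
have dd g : (g * g = z)%g ->
    theta_defect g g = theta w z g g * theta w g z z * inv_sqrt_theta z.
  move=> gg; rewrite /theta_defect /delta1 gg -expr2 sqrtCK; field.
  by rewrite inv_sqrt_theta_neq0 theta_neq0.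
apply: (@signr_inj C); rewrite -!theta_defectE !dd ?sq //.
by rewrite (quaternion_holonomy wZ zZ zz (sq _ ox) (sq _ oy) xy).
Qed.

Lemma trivialization_exists : exists tau : G -> C,
  [/\ forall g, tau g != 0, forall g h, delta1 tau g h = theta w z g h
    & forall g, theta w g z z * tau g ^+ 2 = 1].
Proof.
have [e eP] := sign_cocycle_split oz uniq_z defect_sign_cocycle
  defect_sign_zz defect_sign_order4.
exists (fun g => (-1) ^+ e g * inv_sqrt_theta g); split=> [g|g h|g].
- by rewrite mulf_neq0 ?signr_eq0 ?inv_sqrt_theta_neq0.
- have -> : theta w z g h = theta_defect g h * delta1 inv_sqrt_theta g h.
    rewrite /theta_defect divfK // /delta1.
    by rewrite !mulf_neq0 ?invr_eq0 ?inv_sqrt_theta_neq0.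
  rewrite theta_defectE eP !signr_addb /delta1 invfM invr_sign.
  by field; rewrite inv_sqrt_theta_neq0.
- by rewrite exprMn sqrr_sign mul1r inv_sqrt_theta_sqr.
Qed.
End UniqueInvolution.

Theorem theorem3p1 (R : realType) (G : finGroupType) (A : {group G})
    (cardA : #|A| = 2%N)
    (uniqA : forall B : {group G}, #|B| = 2%N -> B = A)
    (w : G -> G -> G -> R[i]) (wZ : is_normalized_3cocycle w) :
  is_admissible w A.
Proof.
have /cyclicP[z defA] : cyclic A by rewrite prime_cyclic ?cardA.
have oz : #[z]%g = 2%N by rewrite orderE -defA.
have ntz : z != 1%g by rewrite -order_eq1 oz.
have uniq_z (g : G) : #[g]%g = 2%N -> g = z.
  move=> og; have: g \in A by rewrite -(uniqA <[g]>%G) ?cycle_id.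
  rewrite defA cycle2g // => /set2P[] // g1.
  by rewrite g1 order1 in og.
have zZ : z \in 'Z([set: G]).
  apply/centerP; split=> [|x _]; first by rewrite inE.
  by rewrite /commute conjgC (uniq_z (z ^ x)%g) ?orderJ.
have [tau [tau0 dtau tau2]] := trivialization_exists wZ zZ oz uniq_z.
apply: (admissible_of_trivialization wZ zZ _ ntz _ tau0 dtau tau2).
  by rewrite -(expg_order z) oz.
by rewrite defA cycle2g.
Qed.
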